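(* Let $G$ be a finite connected undirected graph (multiple edges and loops allowed), let $<$ be a total order on $E(G)$ and let $A$ be a full orientation of $G$. Let $p$ be a rational number with $0<p<1/2$, and write $p=\frac{k}{2k+l}$ with $k$ and $l$ positive integers. Then the evaluation $R(p)$ of the reliability polynomial of $G$ is the probability that a $(k,l)$-chromatic partial orientation of $G$ chosen uniformly at random is cut minimal with respect to $(<,A)$.
   Context: Let $n=|V(G)|$ and $g=|E(G)|-|V(G)|+1$. The reliability polynomial of $G$ is $R(p)=(1-p)^{n-1}p^{g}\,T_G(1,1/p)$, where $T_G(x,y)$ is the Tutte polynomial of $G$; $R(p)$ is the probability that the subgraph remaining after removing each edge of $G$ independently with probability $p$ is connected and spans the vertices. A partial orientation of $G$ is an orientation of a subset of the edges; the remaining edges are unoriented (each edge, including each loop, has two possible orientations or is unoriented). A full orientation orients every edge. A $(k,l)$-chromatic partial orientation is a partial orientation together with an assignment of one of $k$ colors to each oriented edge and one of $l$ colors to each unoriented edge. A directed cut in a partial orientation is the set of all edges between $X$ and $X^c=V(G)\setminus X$, for some $\emptyset\neq X\subsetneq V(G)$, such that every one of these edges is oriented, and all are oriented from $X$ to $X^c$. Given $(<,A)$, a directed cut is minimal if its minimum edge with respect to $<$ is oriented in the same direction as in $A$. A partial orientation is cut minimal if every directed cut in it is minimal; a $(k,l)$-chromatic partial orientation is cut minimal if its underlying partial orientation is. *)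

(* Defs.v *)
From mathcomp Require Import all_boot all_order all_algebra.

Set Implicit Arguments.
Unset Strict Implicit.
Unset Printing Implicit Defensive.

Import GRing.Theory.
Local Open Scope ring_scope.

(* A finite undirected graph, loops and multiple edges allowed.  The pair
   [ends e] lists the endpoints of [e] in an arbitrary order, whose only role is
   to name the two orientations of [e] by booleans (see [src] and [tgt]); in
   particular a loop has two orientations. *)
Record multigraph := Multigraph {
  vertex : finType;
  edge : finType;
  ends : edge -> vertex * vertex
}.

Definition src (G : multigraph) (e : edge G) (b : bool) : vertex G :=
  if b then (ends e).1 else (ends e).2.

Definition tgt (G : multigraph) (e : edge G) (b : bool) : vertex G :=
  src e (~~ b).

Definition adj (G : multigraph) (S : {set edge G}) : rel (vertex G) :=
  fun x y => [exists e in S, [exists b, (src e b == x) && (tgt e b == y)]].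

Definition connected_graph (G : multigraph) : bool :=
  (0 < #|vertex G|)%N && [forall x, [forall y, connect (adj [set: edge G]) x y]].

(* [n_comp (adj S) predT] is the number of connected components of the spanning
   subgraph (V(G), S). *)
Definition graph_rank (G : multigraph) (S : {set edge G}) : nat :=
  (#|vertex G| - n_comp (adj S) predT)%N.

(* The rank-nullity expansion; the subtractions of naturals never truncate. *)
Definition tutte (G : multigraph) : {poly {poly rat}} :=
  \sum_(S : {set edge G})
     ('X - 1) ^+ (graph_rank [set: edge G] - graph_rank S)
     * ('Y - 1) ^+ (#|S| - graph_rank S).

(* For connected G, the truncated subtraction below is exact. *)
Definition cyclomatic_number (G : multigraph) : nat := (#|edge G| + 1 - #|vertex G|)%N.

(* Value of the reliability polynomial at [p] (meaningful for [p != 0]). *)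
Definition reliability (G : multigraph) (p : rat) : rat :=
  (1 - p) ^+ (#|vertex G| - 1) * p ^+ cyclomatic_number G * (tutte G).[1, 1 / p].

Definition full_orientation (G : multigraph) := {ffun edge G -> bool}.

(* [Some b] means oriented from [src e b] to [tgt e b]; [None] means
   unoriented. *)
Definition partial_orientation (G : multigraph) := {ffun edge G -> option bool}.

(* [inl (b, c)]: orientation [b] and color [c] among k; [inr c]: unoriented,
   color [c] among l. *)
Definition chromatic_orientation (G : multigraph) (k l : nat) :=
  {ffun edge G -> (bool * 'I_k) + 'I_l}.

Definition underlying (G : multigraph) (k l : nat)
    (w : chromatic_orientation G k l) : partial_orientation G :=
  [ffun e => match w e with inl (b, _) => Some b | inr _ => None end].

Definition cut (G : multigraph) (X : {set vertex G}) : {set edge G} :=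
  [set e | ((ends e).1 \in X) != ((ends e).2 \in X)].

Definition directed_cut (G : multigraph) (o : partial_orientation G)
    (C : {set edge G}) : bool :=
  [exists X : {set vertex G},
     [&& X != set0, X \proper [set: vertex G], C == cut X &
         [forall e in C, [exists b,
            [&& o e == Some b, src e b \in X & tgt e b \in ~: X]]]]].

Definition min_edge (T : finType) (le : rel T) (C : {set T}) (e : T) : bool :=
  (e \in C) && [forall f in C, le e f].

Definition minimal_cut (G : multigraph) (le : rel (edge G))
    (A : full_orientation G) (o : partial_orientation G)
    (C : {set edge G}) : bool :=
  [exists e, min_edge le C e && (o e == Some (A e))].

Definition cut_minimal (G : multigraph) (le : rel (edge G))
    (A : full_orientation G) (o : partial_orientation G) : bool :=
  [forall C : {set edge G}, directed_cut o C ==> minimal_cut le A o C].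

Definition uniform_prob (T : finType) (P : pred T) : rat :=
  #|[set x | P x]|%:R / #|T|%:R.

(* Main.v *)
Require Import Defs.
From mathcomp Require Import all_boot all_order all_algebra.
From mathcomp Require Import ring zify.

Import GRing.Theory Num.Theory.

Set Implicit Arguments.
Unset Strict Implicit.
Unset Printing Implicit Defensive.

Local Open Scope ring_scope.

(** Give every edge independently the state unoriented with probability
    [1 - 2 * p] and each orientation with probability [p]: this is the law of the
    underlying partial orientation when [p = k / (2 * k + l)].  The reliability
    at [p] is the probability of connectedness when every edge is instead
    contracted with probability [1 - p] and deleted with probability [p].  Both
    events are instances of a single one.  Let the state of an edge be
    the set of directions in which it may leave a vertex set: none when it is
    unoriented or contracted, one when it is oriented, both when it is deleted.
    Ask that each nontrivial vertex set whose crossing edges all leave it in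
    an allowed direction have a least crossing edge among the oriented ones, and
    that this edge be oriented as in [A].  With no deleted edge this is cut
    minimality ([cut_minimalE]); with no oriented edge it says that the
    contracted edges connect the graph ([connected_byE]).

    The first law is turned into the second one edge at a time, from the greatest
    edge [e] to the least, without changing the probability of the event
    ([mixed_probabilityU1]).  With the states of the other edges fixed, this
    amounts to an identity between indicators: the event holds for
    as many of the two orientations of [e] as it holds for its contraction
    and its deletion ([swap_count]).  Since [e] exceeds all other oriented edges, it is
    the least edge of a cut only when it is alone in it, so deleting [e] keeps
    the event exactly when both orientations do.  The essential point is that
    the event cannot fail for both orientations and hold for the
    contraction: two failing cuts that [e] crosses in opposite directions
    uncross, by intersection or union, to a failing cut that avoids [e]
    ([bad_uncross]).

    What remains is to expand the Tutte polynomial at [(1, 1 / p)] as a sum over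
    connected spanning subgraphs ([reliability_mixed]). *)

(** * States of edges and bad vertex sets *)

(** The directions in which an edge may leave a vertex set [X]: the first
    component allows the crossing from [(ends e).1] to [(ends e).2], the second
    the opposite one.  Thus [(false, false)] is an unoriented edge, which lies
    in no directed cut, and equally a contracted one; [(b, ~~ b)] is an edge
    oriented by [b]; and [(true, true)] is a deleted edge. *)
Definition state := (bool * bool)%type.
Definition allowed (s : state) (b : bool) : bool := if b then s.1 else s.2.
Definition oneway (s : state) : bool := s.1 != s.2.
Definition upd (T : finType) (D : Type) (e : T) (s : D) (t : {ffun T -> D}) :
    {ffun T -> D} :=
  [ffun f => if f == e then s else t f].

Section Cuts.
Variables (G : multigraph) (le : rel (edge G)) (A : full_orientation G).
Hypotheses (le_anti : antisymmetric le) (le_trans : transitive le)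
  (le_total : total le).

Implicit Types (t : {ffun edge G -> state}) (X Y Z : {set vertex G}).

Definition leaves X (e : edge G) (b : bool) : bool :=
  (src e b \in X) && (tgt e b \notin X).

Definition respects t X : bool :=
  [forall e, forall b, leaves X e b ==> allowed (t e) b].

Definition oneway_cut t X : {set edge G} := [set e in cut X | oneway (t e)].

(** [bad t X] witnesses a directed cut that is not minimal.  The minimum is
    taken over the [oneway] edges of the cut only, because the other edges that
    cross a respected [X] are deleted.  A cut with no [oneway] edge is bad: it
    separates the graph once the deleted edges are gone. *)
Definition bad t X : bool :=
  [&& X != set0, X != setT, respects t X &
      [forall e, min_edge le (oneway_cut t X) e ==> ((t e).1 != A e)]].

Definition all_cuts_minimal t : bool := [forall X, ~~ bad t X].

Lemma respectsP t X :
  reflect (forall e b, leaves X e b -> allowed (t e) b) (respects t X).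
Proof.
apply: (iffP forallP) => [h e b|h e]; first by move/forallP: (h e) => /(_ b) /implyP.
by apply/forallP => b; apply/implyP; apply: h.
Qed.

Lemma badP t X :
  reflect [/\ X != set0, X != setT, respects t X &
     forall e, min_edge le (oneway_cut t X) e -> (t e).1 != A e] (bad t X).
Proof.
apply: (iffP and4P) => -[h1 h2 h3 h4]; split=> //.
  by move=> e; move/forallP: h4 => /(_ e) /implyP.
by apply/forallP => e; apply/implyP; apply: h4.
Qed.

Lemma min_edgeP (C : {set edge G}) e :
  reflect (e \in C /\ forall f, f \in C -> le e f) (min_edge le C e).
Proof.
apply: (iffP andP) => -[h1 h2]; split=> //.
  by move=> f; move/forallP: h2 => /(_ f) /implyP.
by apply/forallP => f; apply/implyP; apply: h2.
Qed.

Lemma total_refl : reflexive le.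
Proof. by move=> e; case/orP: (le_total e e). Qed.

Lemma in_oneway_cut t X e :
  (e \in oneway_cut t X) = (e \in cut X) && oneway (t e).
Proof. exact: in_set. Qed.

Lemma exists_min_edge (C : {set edge G}) e : e \in C -> exists f, min_edge le C f.
Proof.
move=> eC.
have [f fC hf] := @extremumP _ _ le e (mem C) id total_refl le_trans le_total eC.
by exists f; apply/min_edgeP; split.
Qed.

Lemma min_edge_uniq (C : {set edge G}) e f :
  min_edge le C e -> min_edge le C f -> e = f.
Proof.
move=> /min_edgeP [eC he] /min_edgeP [fC hf].
by apply: le_anti; rewrite he // hf.
Qed.

Lemma mem_cut X e : (e \in cut X) = [exists b, leaves X e b].
Proof.
rewrite inE; apply/idP/existsP.
  case h1: (_ \in X); case h2: (_ \in X) => // _; last first.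
    by exists false; rewrite /leaves /src /tgt /= h1 h2.
  by exists true; rewrite /leaves /src /tgt /= h1 h2.
by case=> -[] /andP []; rewrite /src /tgt /= => -> /negbTE ->.
Qed.

Lemma leaves_cut X e b : leaves X e b -> e \in cut X.
Proof. by move=> h; rewrite mem_cut; apply/existsP; exists b. Qed.

Lemma leavesC X e b : leaves (~: X) e b = leaves X e (~~ b).
Proof. by rewrite /leaves /tgt !inE negbK andbC negbK. Qed.

Lemma cutC X : cut (~: X) = cut X.
Proof.
by apply/setP => e; rewrite !inE; case: (_ \in X); case: (_ \in X).
Qed.

Lemma leaves_nontrivial X e b : leaves X e b -> (X != set0) && (X != setT).
Proof.
case/andP => h1 h2; apply/andP; split; apply/eqP => h; first by rewrite h inE in h1.
by rewrite h inE in h2.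
Qed.

Lemma updE t e s : upd e s t e = s.
Proof. by rewrite ffunE eqxx. Qed.

Lemma upd_neq t e s f : f != e -> upd e s t f = t f.
Proof. by rewrite ffunE => /negbTE ->. Qed.

(** * Exchanging one edge *)

Section Swap.
Variables (t : {ffun edge G -> state}) (e : edge G).
Hypothesis e_max : forall f, oneway (t f) -> f != e -> le f e.

Lemma oneway_cut_upd s X f : f != e ->
  (f \in oneway_cut (upd e s t) X) = (f \in cut X) && oneway (t f).
Proof. by move=> fe; rewrite in_oneway_cut upd_neq. Qed.

Lemma respects_upd s X :
  (forall f b, f != e -> leaves X f b -> allowed (t f) b) ->
  (forall b, leaves X e b -> allowed s b) -> respects (upd e s t) X.
Proof.
move=> h1 h2; apply/respectsP => f b.
case: (eqVneq f e) => [->|fe]; first by rewrite updE; apply: h2.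
by rewrite upd_neq //; apply: h1.
Qed.

Lemma respects_upd_other s X f b : respects (upd e s t) X -> f != e ->
  leaves X f b -> allowed (t f) b.
Proof. by move=> /respectsP h fe /h; rewrite upd_neq. Qed.

Lemma bad_upd_not_cut s s' X : e \notin cut X ->
  bad (upd e s t) X -> bad (upd e s' t) X.
Proof.
move=> eX /badP [X0 XT rX hX]; apply/badP; split=> //.
  apply: respects_upd => [f b fe|b /leaves_cut]; last by rewrite (negbTE eX).
  exact: respects_upd_other rX fe.
have -> : oneway_cut (upd e s' t) X = oneway_cut (upd e s t) X.
  apply/setP => f; case: (eqVneq f e) => [->|fe]; last by rewrite !oneway_cut_upd.
  by rewrite !in_oneway_cut (negbTE eX).
move=> f hf; have := hX f hf; rewrite !upd_neq //.
all: apply/eqP => fe; case/min_edgeP: hf.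
all: by rewrite fe in_oneway_cut (negbTE eX).
Qed.

Lemma leaves_both X b : leaves X e b -> leaves X e (~~ b) = false.
Proof.
rewrite /leaves /tgt negbK => /andP [-> h].
by rewrite andbF.
Qed.

Lemma allowed_oneway b c : allowed (b, ~~ b) c = (c == b).
Proof. by case: b; case: c. Qed.

(** An [X] that respects the contracted state of [e] is not crossed by [e]. *)
Lemma bad_none s X : bad (upd e (false, false) t) X -> bad (upd e s t) X.
Proof.
move=> h; apply: bad_upd_not_cut (h); apply/negP.
rewrite mem_cut => /existsP [b hb].
case/badP: h => _ _ /respectsP /(_ _ _ hb).
by rewrite updE; case: b {hb}.
Qed.

(** Deleting [e] removes the greatest oriented edge of the cut, so the minimum
    can change only if [e] was the whole cut, which then becomes empty. *)
Lemma bad_both b X : bad (upd e (b, ~~ b) t) X -> bad (upd e (true, true) t) X.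
Proof.
move=> /badP [X0 XT rX hX]; apply/badP; split=> //.
  apply: respects_upd => [f c fe|[]//]; exact: respects_upd_other rX fe.
move=> f /min_edgeP [fC hf].
have fe : f != e.
  by apply/eqP => fe; move: fC; rewrite fe in_oneway_cut updE andbF.
rewrite upd_neq //; rewrite -(upd_neq t (b, ~~ b) fe); apply: hX.
rewrite oneway_cut_upd // in fC.
apply/min_edgeP; split; first by rewrite oneway_cut_upd.
move=> g; case: (eqVneq g e) => [-> _|ge].
  by apply: e_max fe; case/andP: fC.
by move=> hg; apply: hf; move: hg; rewrite !oneway_cut_upd.
Qed.

(** If [X] is crossed by [e] and bad when [e] is deleted, orient [e] out of [X].
    The cut either keeps its minimum, hence stays bad, or it was empty and
    becomes [e] alone.  In the latter case all other edges across [X] are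
    deleted, so the complement of [X] is respected when [e] is reversed, and one
    of the two orientations of [e] disagrees with [A]. *)
Lemma bad_some_oneway X : bad (upd e (true, true) t) X ->
  exists b Y, bad (upd e (b, ~~ b) t) Y.
Proof.
move=> badX; case eX: (e \in cut X); last first.
  by exists true, X; apply: bad_upd_not_cut badX; rewrite eX.
move: eX; rewrite mem_cut => /existsP [b hb].
case: (boolP (bad (upd e (b, ~~ b) t) X)) => [h|nbad]; first by exists b, X.
(* Here orienting [e] out of [X] makes the cut minimal: [e] is alone in it. *)
exists (~~ b), (~: X).
case/badP: badX => X0 XT rX hX.
have rXb : respects (upd e (b, ~~ b) t) X.
  apply: respects_upd => [f c fe|c hc]; first exact: respects_upd_other rX fe.
  rewrite allowed_oneway; apply/eqP; case: (eqVneq c b) => // cb.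
  have E : c = ~~ b by case: (c) (b) cb => [] [].
  by rewrite E leaves_both in hc.
have [f minf fA] : exists2 f, min_edge le (oneway_cut (upd e (b, ~~ b) t) X) f
                     & (upd e (b, ~~ b) t f).1 == A f.
  move: nbad; rewrite /bad X0 XT rXb /= negb_forall => /existsP [f].
  by rewrite negb_imply negbK => /andP [h1 h2]; exists f.
case/min_edgeP: (minf) => fC hf.
have fe : f = e.
  apply/eqP; apply/negPn; apply/negP => fe.
  move: fA; apply/negP; rewrite upd_neq // -(upd_neq t (true, true) fe).
  apply: hX; apply/min_edgeP; split; first by move: fC; rewrite !oneway_cut_upd.
  move=> g; case: (eqVneq g e) => [->|ge]; first by rewrite in_oneway_cut updE andbF.
  by move=> hg; apply: hf; move: hg; rewrite !oneway_cut_upd.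
subst f.
have noway g : g != e -> g \in cut X -> ~~ oneway (t g).
  move=> ge gX; apply/negP => og.
  have /hf leg : g \in oneway_cut (upd e (b, ~~ b) t) X.
    by rewrite oneway_cut_upd // gX.
  by case/eqP: (ge); apply: le_anti; rewrite leg e_max.
rewrite updE /= in fA.
apply/badP; split.
- by rewrite -setCT (inj_eq (@setC_inj _)).
- by rewrite -setC0 (inj_eq (@setC_inj _)).
- apply: respects_upd => [g c ge|c]; rewrite leavesC => hc.
    have := respects_upd_other rX ge hc.
    have := noway g ge (leaves_cut hc).
    by rewrite /oneway negbK /allowed; case: c {hc} => /eqP ->.
  move/respectsP: rXb => /(_ _ _ hc); rewrite updE !allowed_oneway.
  by case: (c) (b) => [] [].
move=> g /min_edgeP [gC _].
have -> : g = e.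
  apply/eqP; apply/negPn/negP => ge; move: gC.
  rewrite oneway_cut_upd // cutC => /andP [gX].
  by rewrite (negbTE (noway g ge gX)).
by rewrite updE /= -(eqP fA); case: (b).
Qed.

(** Uncrossing.  When [e] leaves [X] and enters [Y], neither [X :&: Y] nor
    [X :|: Y] is crossed by [e], and an edge that leaves one of these two sets
    leaves [X] or [Y].  The smaller minimum [fx] is not [e]: otherwise [e]
    would be the minimum of both cuts, and one orientation of [e] agrees with [A].
    It leaves the intersection or the union, and stays the minimum
    there. *)
Lemma bad_uncross b X Y fx fy :
  bad (upd e (b, ~~ b) t) X -> bad (upd e (~~ b, b) t) Y ->
  leaves X e b -> leaves Y e (~~ b) ->
  min_edge le (oneway_cut (upd e (b, ~~ b) t) X) fx ->
  min_edge le (oneway_cut (upd e (~~ b, b) t) Y) fy -> le fx fy ->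
  exists Z, bad (upd e (false, false) t) Z.
Proof.
move=> /badP [_ _ rX hX] /badP [_ _ rY hY] eX eY minx miny lexy.
have fxA := hX _ minx; have fyA := hY _ miny.
case/min_edgeP: minx => fxC minx; case/min_edgeP: miny => fyC miny.
have fxe : fx != e.
  apply/eqP => E; subst fx.
  have fye : fy = e.
    apply: le_anti; rewrite lexy andbT; case: (eqVneq fy e) => [->|fye].
      exact: total_refl.
    by apply: e_max (fye); move: fyC; rewrite oneway_cut_upd // => /andP [].
  by subst fy; move: fxA fyA; rewrite !updE /=; case: (b) (A e) => [] [].
rewrite upd_neq // in fxA.
move: (fxC); rewrite oneway_cut_upd // mem_cut => /andP [/existsP [c hc] ofx].
(* [fx] may be crossed only in direction [c]: it is oriented, and [X] respects it. *)
have fxY : leaves Y fx (~~ c) = false.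
  apply/negP => hY'.
  have := respects_upd_other rX fxe hc; have := respects_upd_other rY fxe hY'.
  by move: ofx; rewrite /oneway /allowed; case: (t fx) (c) => [[] []] [].
have key Z : leaves Z fx c -> ~~ (leaves Z e true || leaves Z e false) ->
    (forall g d, leaves Z g d -> leaves X g d || leaves Y g d) ->
    bad (upd e (false, false) t) Z.
  move=> Zfx Ze sub; have /andP [Z0 ZT] := leaves_nontrivial Zfx.
  apply/badP; split=> //.
    apply: respects_upd => [g d ge /sub /orP [] | d hd].
    - exact: respects_upd_other rX ge.
    - exact: respects_upd_other rY ge.
    by case/negP: Ze; case: d hd => ->; rewrite ?orbT.
  move=> g ming.
  have -> : g = fx.
    apply: min_edge_uniq ming _; apply/min_edgeP; split.
      by rewrite oneway_cut_upd // ofx (leaves_cut Zfx).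
    move=> h; case: (eqVneq h e) => [->|he]; first by rewrite in_oneway_cut updE andbF.
    rewrite oneway_cut_upd // mem_cut => /andP [/existsP [d /sub hd] oh].
    case/orP: hd => /leaves_cut hd.
      by apply: minx; rewrite oneway_cut_upd // hd.
    by apply: le_trans lexy (miny _ _); rewrite oneway_cut_upd // hd.
  by rewrite upd_neq.
move: eX eY hc fxY; rewrite /leaves /tgt !negbK.
move=> /andP [eX1 eX2] /andP [eY1 eY2] /andP [fX1 fX2] fY.
case: (boolP (src fx c \in Y)) => sY.
  exists (X :&: Y); apply: key.
  - by rewrite /leaves /tgt !inE fX1 sY (negbTE fX2).
  - rewrite /leaves /tgt !inE.
    by move: eX1 eX2 eY1 eY2; case: (b) => /= -> /negbTE-> -> /negbTE->.
  move=> g d; rewrite /leaves !inE negb_and.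
  by case/andP => /andP [-> ->].
exists (X :|: Y); apply: key.
- rewrite /leaves /tgt !inE fX1 (negbTE fX2) /=.
  by move: fY; rewrite sY andbT => ->.
- rewrite /leaves /tgt !inE.
  by move: eX1 eX2 eY1 eY2; case: (b) => /= -> /negbTE-> -> /negbTE->.
move=> g d; rewrite /leaves !inE negb_or.
by case/andP => /orP [] -> /andP [-> ->]; rewrite ?orbT.
Qed.

Lemma bad_none_of_oneway X Y :
  bad (upd e (true, false) t) X -> bad (upd e (false, true) t) Y ->
  exists Z, bad (upd e (false, false) t) Z.
Proof.
move=> badX badY.
have aux b Z : bad (upd e (b, ~~ b) t) Z -> e \in cut Z ->
    leaves Z e b /\ exists f, min_edge le (oneway_cut (upd e (b, ~~ b) t) Z) f.
  case/badP=> _ _ /respectsP rZ _ eZ; split.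
    move: (eZ); rewrite mem_cut => /existsP [c hc].
    by have := rZ _ _ hc; rewrite updE allowed_oneway => /eqP <-.
  by apply: (exists_min_edge (e := e)); rewrite in_oneway_cut eZ updE; case: (b).
case: (boolP (e \in cut X)) => [/(aux true _ badX) [eX [fx minx]]|eX]; last first.
  by exists X; apply: bad_upd_not_cut badX.
case: (boolP (e \in cut Y)) => [/(aux false _ badY) [eY [fy miny]]|eY]; last first.
  by exists Y; apply: bad_upd_not_cut badY.
case/orP: (le_total fx fy) => h.
  exact: (bad_uncross (b := true)) badX badY eX eY minx miny h.
exact: (bad_uncross (b := false)) badY badX eY eX miny minx h.
Qed.

(** The contraction of [e] is good exactly if at least one of its orientations
    is ([bad_none], [bad_none_of_oneway]), and the deletion exactly if both are
    ([bad_both], [bad_some_oneway]). *)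
Lemma swap_count :
  (all_cuts_minimal (upd e (true, false) t)
   + all_cuts_minimal (upd e (false, true) t)
   = all_cuts_minimal (upd e (false, false) t)
     + all_cuts_minimal (upd e (true, true) t))%N.
Proof.
have nokP s : reflect (exists X, bad (upd e s t) X) (~~ all_cuts_minimal (upd e s t)).
  apply: (iffP idP); last first.
    by case=> X hX; apply/negP => /forallP /(_ X); rewrite hX.
  by rewrite negb_forall => /existsP [X]; rewrite negbK => hX; exists X.
pose ok s := all_cuts_minimal (upd e s t).
have toN s : ~~ ok (false, false) ==> ~~ ok s.
  by apply/implyP=> /nokP [X hX]; apply/nokP; exists X; apply: bad_none.
have toB b : ~~ ok (b, ~~ b) ==> ~~ ok (true, true).
  by apply/implyP=> /nokP [X hX]; apply/nokP; exists X; apply: bad_both hX.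
have ofB : ~~ ok (true, true) ==> ~~ ok (true, false) || ~~ ok (false, true).
  apply/implyP=> /nokP [X /bad_some_oneway [b [Y hY]]].
  by apply/orP; case: b hY => hY; [left|right]; apply/nokP; exists Y.
have toO : ~~ ok (true, false) && ~~ ok (false, true) ==> ~~ ok (false, false).
  apply/implyP=> /andP [/nokP [X hX] /nokP [Y hY]]; apply/nokP.
  exact: bad_none_of_oneway hX hY.
move: (toN (true, false)) (toN (false, true)) (toB true) (toB false) ofB toO.
rewrite /= -!/(ok _).
by do 4![case: (ok _)].
Qed.

End Swap.
End Cuts.

(** * Partial orientations and spanning subgraphs as states *)

Definition state_of_orientation (G : multigraph) (o : partial_orientation G) :
    {ffun edge G -> state} :=
  [ffun e => if o e is Some b then (b, ~~ b) else (false, false)].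

Definition state_of_set (G : multigraph) (S : {set edge G}) :
    {ffun edge G -> state} :=
  [ffun e => (e \notin S, e \notin S)].

Lemma cut_minimalE (G : multigraph) (le : rel (edge G)) (A : full_orientation G)
    (o : partial_orientation G) :
  cut_minimal le A o = all_cuts_minimal le A (state_of_orientation o).
Proof.
set t := state_of_orientation o.
have ocut X : respects t X -> oneway_cut t X = cut X.
  move/respectsP => rX; apply/setP => e; rewrite in_oneway_cut.
  case eX: (e \in cut X) => //=; move: eX; rewrite mem_cut => /existsP [b /rX].
  by rewrite /t ffunE; case: (o e) => [[]|]; case: (b).
have tA e : oneway (t e) -> ((t e).1 == A e) = (o e == Some (A e)).
  by rewrite /t ffunE; case: (o e) => [[]|] //=; case: (A e).
apply/forallP/forallP => [cm X|ac C].
  apply/negP => /badP [X0 XT rX hX].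
  have dc : directed_cut o (cut X).
    apply/existsP; exists X; rewrite X0 properT XT eqxx /=.
    apply/forallP => e; apply/implyP; rewrite mem_cut => /existsP [b hb].
    apply/existsP; exists b.
    move/respectsP: rX => /(_ _ _ hb); rewrite /t ffunE.
    move: hb; rewrite /leaves !inE => /andP [-> ->].
    by case: (o e) => [[]|]; case: (b).
  have := cm (cut X); rewrite dc => /existsP [e /andP [mine oe]].
  have := hX e; rewrite ocut // mine => /(_ isT).
  rewrite tA ?oe //.
  by move/min_edgeP: mine => [+ _]; rewrite -ocut // in_oneway_cut => /andP [].
apply/implyP => /existsP [X /and4P [X0 XT /eqP -> /forallP dX]].
have rX : respects t X.
  apply/respectsP => e b hb; have /implyP/(_ (leaves_cut hb)) := dX e.
  case/existsP => c /and3P [/eqP oe sc tc]; rewrite /t ffunE oe.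
  move: hb sc tc; rewrite /leaves /tgt inE.
  by case: (b) (c) => [] [] //= /andP [-> /negbTE ->].
have := ac X; rewrite /bad X0 -properT XT rX /= negb_forall => /existsP [e].
rewrite negb_imply negbK ocut // => /andP [mine].
rewrite tA => [oe|]; first by apply/existsP; exists e; rewrite mine.
by move/min_edgeP: mine => [+ _]; rewrite -ocut // in_oneway_cut => /andP [].
Qed.

Section Components.
Variables (G : multigraph) (S : {set edge G}).

Lemma adj_sym : symmetric (adj S).
Proof.
suff aux x y : adj S x y -> adj S y x by move=> x y; apply/idP/idP; apply: aux.
case/existsP => e /andP [eS /existsP [b /andP [h1 h2]]].
apply/existsP; exists e; rewrite eS; apply/existsP; exists (~~ b).
by rewrite /tgt negbK h1 -/(tgt e b) h2.
Qed.

Lemma adj_leaves (X : {set vertex G}) x y : adj S x y -> x \in X -> y \notin X ->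
  exists2 e, e \in S & exists b, leaves X e b.
Proof.
case/existsP => e /andP [eS /existsP [b /andP [/eqP <- /eqP <-]]] hx hy.
by exists e => //; exists b; rewrite /leaves hx.
Qed.

Definition connected_by := [forall x, forall y, connect (adj S) x y].

Lemma n_comp_eq1 : (0 < #|vertex G|)%N ->
  (n_comp (adj S) predT == 1%N) = connected_by.
Proof.
move=> /card_gt0P [x0 _]; have csym := sym_connect_sym adj_sym.
apply/eqP/idP => [c1|/forallP conn].
  apply/forallP => x; apply/forallP => y; apply/(fingraph.rootP csym).
  have /card_le1_eqP : (n_comp (adj S) predT <= 1)%N by rewrite c1.
  by apply; rewrite inE /= andbT; apply: roots_root.
rewrite -(n_comp_connect csym x0); apply: eq_n_comp_r => x.
by rewrite !inE; symmetry; apply: (forallP (conn x0)).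
Qed.

Lemma connected_cut (X : {set vertex G}) :
  connected_by -> X != set0 -> X != setT ->
  exists2 e, e \in S & exists b, leaves X e b.
Proof.
move=> conn /set0Pn [x xX] XT.
have /subsetPn [y _ yX] : ~~ ([set: vertex G] \subset X) by rewrite subTset.
case: (boolP [exists e in S, exists b, leaves X e b]).
  by case/existsP => e /andP [eS /existsP [b hb]]; exists e => //; exists b.
move=> nocross; case/negP: yX.
have /forallP/(_ x)/forallP/(_ y) xy := conn.
rewrite -(closed_connect _ xy) //.
apply: (intro_closed (sym_connect_sym adj_sym)) => u v uv uX.
apply/negPn/negP => vX; case/negP: nocross.
have [e eS [b hb]] := adj_leaves uv uX vX.
by apply/existsP; exists e; rewrite eS; apply/existsP; exists b.
Qed.

(** All edges are contracted or deleted here, so every respected nontrivial [X]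
    is bad, and such an [X] is a union of components of [S]. *)
Lemma connected_byE le A : connected_by =
  all_cuts_minimal le A (state_of_set S).
Proof.
apply/idP/forallP => [conn X|ac].
  apply/negP => /badP [X0 XT /respectsP rX _].
  have [e eS [b /rX]] := connected_cut conn X0 XT.
  by rewrite ffunE /allowed eS; case: b.
apply/forallP => x; apply/forallP => y; apply/negPn/negP => nxy.
pose X := [set z | connect (adj S) x z].
have /negP := ac X; case; apply/badP; split.
- by apply/set0Pn; exists x; rewrite inE connect0.
- by apply/eqP => XT; have := in_setT y; rewrite -XT inE (negbTE nxy).
- apply/respectsP => e b; rewrite /leaves !inE => /andP [h1 h2].
  rewrite ffunE /allowed; case: (boolP (e \in S)) => [eS|_]; last by case: (b).
  case/negP: h2; apply: (connect_trans h1); apply: connect1.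
  by apply/existsP; exists e; rewrite eS; apply/existsP; exists b; rewrite !eqxx.
move=> e /min_edgeP [+ _]; rewrite in_oneway_cut ffunE /oneway eqxx.
by rewrite andbF.
Qed.

(** Growing a vertex set along crossing edges of [S] adds to the edges inside it
    one new edge per vertex. *)
Lemma connected_size : connected_by -> (#|vertex G| <= #|S| + 1)%N.
Proof.
move=> conn.
pose inner (X : {set vertex G}) :=
  [set e in S | ((ends e).1 \in X) && ((ends e).2 \in X)].
have grow k : (k < #|vertex G|)%N ->
    exists X : {set vertex G}, #|X| = k.+1 /\ (k <= #|inner X|)%N.
  elim: k => [|k IHk] hk.
    by have /card_gt0P [x _] := hk; exists [set x]; rewrite cards1.
  have [X [cX kX]] := IHk (ltnW hk).
  have [] := @connected_cut X conn.
  - by rewrite -card_gt0 cX.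
  - by apply/eqP => XT; move: hk; rewrite -cX XT cardsT ltnn.
  move=> e eS [b /andP [sX tX]].
  exists (tgt e b |: X); rewrite cardsU1 tX cX; split=> //.
  apply: (@leq_trans #|e |: inner X|).
    rewrite cardsU1 inE; suff -> : ((ends e).1 \in X) && ((ends e).2 \in X) = false.
      by rewrite andbF ltnS.
    by move: sX tX; rewrite /tgt /src; case: (b) => /= -> /negbTE ->.
  apply: subset_leq_card; apply/subsetP => f; rewrite !inE => /orP [/eqP ->|].
    rewrite eS; move: sX tX; rewrite /tgt /src.
    by case: (b) => /= -> _; rewrite eqxx !orbT.
  by case/and3P => -> -> ->; rewrite !orbT.
case: (posnP #|vertex G|) => [-> //|n0].
have [|X [_ hX]] := grow #|vertex G|.-1; first by rewrite prednK.
have : (#|inner X| <= #|S|)%N.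
  by apply: subset_leq_card; apply/subsetP => e; rewrite in_set => /andP [].
by lia.
Qed.
End Components.

(** * Random states *)

(** The law of the state of an edge under a random chromatic partial
    orientation. *)
Definition orientation_weight (p : rat) (s : state) : rat :=
  if s.1 && s.2 then 0 else if s.1 || s.2 then p else 1 - 2 * p.
(** The law of the state of an edge that is deleted with probability [p] and
    contracted otherwise. *)
Definition percolation_weight (p : rat) (s : state) : rat :=
  if s.1 && s.2 then p else if s.1 || s.2 then 0 else 1 - p.

(** Expectation of [H] under a product law each factor of which is the image
    of [v] by [st]. *)
Lemma sum_pushforward (R : comPzRingType) (E C D : finType) (st : C -> D)
    (v : C -> R) (w : D -> R) (H : {ffun E -> D} -> R) :
  (forall s, w s = \sum_(c | st c == s) v c) ->
  \sum_(t : {ffun E -> D}) (\prod_e w (t e)) * H t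
  = \sum_(x : {ffun E -> C}) (\prod_e v (x e)) * H [ffun e => st (x e)].
Proof.
move=> hw.
rewrite [RHS](partition_big (fun x : {ffun E -> C} => [ffun e => st (x e)]) predT) //=.
apply: eq_bigr => t _.
under eq_bigr do rewrite hw.
rewrite bigA_distr_big_dep mulr_suml.
apply: eq_big => [x|x /familyP hx].
  apply/familyP/eqP => [h|h e].
    by apply/ffunP => e; rewrite ffunE; exact/eqP/(h e).
  by rewrite unfold_in -h ffunE eqxx.
congr (_ * H _); apply/ffunP => e; rewrite ffunE.
by have := hx e; rewrite unfold_in => /eqP.
Qed.

(** Exchanging the value of [t] at [e] with [s] is an involution of the pairs
    [(t, s)]. *)
Lemma resample (R : pzRingType) (E D : finType) (e : E) (F : {ffun E -> D} -> R) :
  \sum_(t : {ffun E -> D}) \sum_s F (upd e s t) = (\sum_t F t) *+ #|D|.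
Proof.
rewrite pair_big /= -sumr_const.
pose h (ts : {ffun E -> D} * D) := (upd e ts.2 ts.1, ts.1 e).
have hK : involutive h.
  case=> t s; congr pair; last by rewrite /= ffunE eqxx.
  by apply/ffunP => f; rewrite !ffunE /=; case: eqP => [->|].
rewrite [RHS]exchange_big pair_big /= (reindex_inj (inv_inj hK)) /=.
by apply: eq_bigr => -[t s] _ /=; congr F; case: (hK (t, s)).
Qed.

(** * From orientations to percolation, one edge at a time *)

Definition mixed_weight (E : finType) (p : rat) (D : {set E}) (e : E) : state -> rat :=
  if e \in D then percolation_weight p else orientation_weight p.

Lemma sum_state (R : nmodType) (F : state -> R) :
  \sum_s F s = F (true, false) + F (false, true) + (F (false, false) + F (true, true)).
Proof.
rewrite (eq_bigr (fun s => F (s.1, s.2))) => [|[]//].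
rewrite -(pair_bigA _ (fun a b => F (a, b))) /= big_bool !big_bool /=.
by rewrite !addrA [RHS]addrC !addrA.
Qed.

Section Exchange.
Variables (G : multigraph) (le : rel (edge G)) (A : full_orientation G) (p : rat).
Hypotheses (le_anti : antisymmetric le) (le_trans : transitive le)
  (le_total : total le).

Definition mixed_probability (D : {set edge G}) : rat :=
  \sum_(t : {ffun edge G -> state})
     (\prod_e mixed_weight p D e (t e)) * (all_cuts_minimal le A t)%:R.

(** With [a] and [b] the indicators for the two orientations of [e], and [c] and
    [d] those for its contraction and deletion, the identity [a + b = c + d] of
    [swap_count] gives
    [p * a + p * b + (1 - 2 * p) * c = (1 - p) * c + p * d].
    It applies because an edge greater than [e] lies in [D], where [oneway]
    states have weight zero. *)
Lemma mixed_probabilityU1 (D : {set edge G}) e :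
  e \notin D -> (forall f, f \notin D -> le f e) ->
  mixed_probability (e |: D) = mixed_probability D.
Proof.
move=> eD e_max.
apply: (mulIf (x := #|{: state}|%:R)).
  by rewrite pnatr_eq0 card_prod card_bool.
rewrite !mulr_natr /mixed_probability -!(resample e).
apply: eq_bigr => t _.
have split_prod (D' : {set edge G}) (s : state) :
    (forall f, f != e -> (f \in D') = (f \in D)) ->
    \prod_f mixed_weight p D' f (upd e s t f)
    = mixed_weight p D' e s * \prod_(f | f != e) mixed_weight p D f (t f).
  move=> hD; rewrite (bigD1 e) //= updE; congr (_ * _).
  by apply: eq_bigr => f fe; rewrite upd_neq // /mixed_weight hD.
have eU f : f != e -> (f \in e |: D) = (f \in D).
  by move=> fe; rewrite in_setU1 (negbTE fe).
under eq_bigr do rewrite (split_prod _ _ eU) mulrAC mulrC.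
under [RHS]eq_bigr do rewrite split_prod // mulrAC mulrC.
rewrite -!mulr_sumr; case: (eqVneq (\prod_(f | f != e) mixed_weight p D f (t f)) 0).
  by move=> ->; rewrite !mul0r.
move=> /prodf_neq0 nz; congr (_ * _).
have e_max' f : oneway (t f) -> f != e -> le f e.
  move=> of1 fe; apply: e_max; apply/negP => fD.
  have := nz f fe; rewrite /mixed_weight fD /percolation_weight.
  by move: of1; case: (t f) => [[] []] //=; rewrite eqxx.
have := congr1 (fun n => n%:R : rat) (swap_count A le_anti le_trans le_total e_max').
rewrite !sum_state /mixed_weight setU11 (negbTE eD).
rewrite /percolation_weight /orientation_weight /= !natrD.
set a := (all_cuts_minimal _ _ _)%:R; set b := (all_cuts_minimal _ _ _)%:R.
set c := (all_cuts_minimal _ _ _)%:R; set d := (all_cuts_minimal _ _ _)%:R.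
move=> h; have -> : d = a + b - c by rewrite h; ring.
ring.
Qed.

Lemma mixed_probability_const (D : {set edge G}) :
  mixed_probability D = mixed_probability setT.
Proof.
move: {2}#|~: D| (leqnn #|~: D|) => n; elim: n D => [|n IHn] D hD.
  by congr mixed_probability; apply: setC_inj; apply/eqP; rewrite setCT -cards_eq0 -leqn0.
case: (set_0Vmem (~: D)) => [D0|[f fD]].
  by congr mixed_probability; apply: setC_inj; rewrite setCT.
have [e eD e_max] := @extremumP _ _ (fun x y => le y x) f (mem (~: D)) id
  (total_refl le_total) (fun y x z h1 h2 => le_trans h2 h1) (fun x y => le_total y x) fD.
have eD' : e \notin D by rewrite -in_setC.
rewrite -(mixed_probabilityU1 eD'); last first.
  by move=> g gD; apply: e_max; rewrite -in_setC in gD.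
apply: IHn; move: hD; rewrite (cardsD1 e (~: D)) inE eD' ltnS.
by rewrite setCU setIC -setDE.
Qed.
End Exchange.

(** * The two extreme laws *)

Lemma mixed_probability_set0 (G : multigraph) (le : rel (edge G))
    (A : full_orientation G) (p : rat) (k l : nat) :
  (0 < k)%N -> p = k%:R / (2 * k + l)%N%:R ->
  mixed_probability le A p set0 =
    uniform_prob (fun w : chromatic_orientation G k l =>
                    cut_minimal le A (underlying w)).
Proof.
move=> k0 pE; set N : rat := (2 * k + l)%N%:R in pE.
have N0 : N != 0 by rewrite pnatr_eq0; lia.
pose st (c : bool * 'I_k + 'I_l) : state :=
  if c is inl (b, _) then (b, ~~ b) else (false, false).
have sum_st (g : state -> rat) :
    \sum_c g (st c) = (g (true, false) + g (false, true)) *+ k + g (false, false) *+ l.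
  rewrite big_sumType /= sumr_const card_ord; congr (_ + _).
  rewrite (eq_bigr (fun c => g (c.1, ~~ c.1))) => [|[]//].
  rewrite -(pair_bigA _ (fun b _ => g (b, ~~ b))) /= big_bool /= !sumr_const.
  by rewrite card_ord mulrnDl.
have weight s : orientation_weight p s = \sum_(c | st c == s) N^-1.
  rewrite big_mkcond (sum_st (fun s' => if s' == s then N^-1 else 0)).
  have kN : p = N^-1 *+ k by rewrite -[RHS]mulr_natl.
  have NE : N = 2 * k%:R + l%:R by rewrite /N natrD natrM.
  have lN : 1 - 2 * p = N^-1 *+ l.
    rewrite -[RHS]mulr_natl pE; apply: (mulIf N0).
    by rewrite mulrBl mul1r -!mulrA mulVf // !mulr1 {1}NE; ring.
  by case: s => [[] []]; rewrite /orientation_weight /=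
    ?lN -?kN ?addr0 ?add0r ?mul0rn ?addr0 ?add0r.
rewrite /mixed_probability /mixed_weight.
under eq_bigr => t _ do under eq_bigr => e _ do rewrite in_set0.
rewrite (sum_pushforward _ weight) /uniform_prob prodr_const -mulr_sumr.
have -> : #|{: chromatic_orientation G k l}|%:R = N ^+ #|edge G|.
  by rewrite card_ffun card_sum card_prod card_bool !card_ord natrX.
rewrite exprVn mulrC; congr (_ * _).
rewrite -sum1_card natr_sum [RHS]big_mkcond; apply: eq_bigr => w _.
have -> : [ffun e => st (w e)] = state_of_orientation (underlying w).
  by apply/ffunP => e; rewrite !ffunE; case: (w e) => [[]|].
by rewrite inE cut_minimalE; case: (all_cuts_minimal _ _ _).
Qed.

(** At [x = 1] the factor [(x - 1) ^+ _] of the Tutte polynomial keeps exactly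
    the connected spanning subgraphs [S], and the remaining powers combine to
    [(1 - p) ^+ #|S| * p ^+ (#|edge G| - #|S|)]. *)
Lemma reliability_mixed (G : multigraph) (le : rel (edge G))
    (A : full_orientation G) (p : rat) :
  connected_graph G -> 0 < p ->
  reliability G p = mixed_probability le A p setT.
Proof.
move=> /andP [n0 conn] p0.
have pn0 : p != 0 by rewrite lt0r_neq0.
pose st (b : bool) : state := (~~ b, ~~ b).
have weight s : percolation_weight p s = \sum_(b | st b == s) (if b then 1 - p else p).
  rewrite big_mkcond big_bool /=.
  by case: s => [[] []]; rewrite /percolation_weight /= ?addr0 ?add0r.
rewrite /mixed_probability /mixed_weight.
under [RHS]eq_bigr => t _ do under eq_bigr => e _ do rewrite in_setT.
rewrite (sum_pushforward _ weight).
rewrite (reindex (fun S : {set edge G} => [ffun e => e \in S])) /=; last first.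
  exists (fun x : {ffun edge G -> bool} => [set e | x e]) => x _.
    by apply/setP => e; rewrite inE ffunE.
  by apply/ffunP => e; rewrite ffunE inE.
rewrite /reliability /tutte !horner_sum mulr_sumr; apply: eq_bigr => S _.
have -> : [ffun e => st ([ffun f => f \in S] e)] = state_of_set S.
  by apply/ffunP => e; rewrite !ffunE.
have -> : \prod_e (if [ffun f => f \in S] e then 1 - p else p)
    = (1 - p) ^+ #|S| * p ^+ (#|edge G| - #|S|).
  under eq_bigr do rewrite ffunE.
  rewrite (bigID (mem S)) /= (eq_bigr (fun _ => 1 - p)) => [|e ->//].
  rewrite prodr_const (eq_bigr (fun _ => p)) => [|e /negbTE -> //].
  rewrite prodr_const; congr (_ * _ ^+ _).
  rewrite -(cardC (mem S)) addKn.
  by apply: eq_card => e; rewrite !inE.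
have -> : (('X - 1) ^+ (graph_rank [set: edge G] - graph_rank S)
           * ('Y - 1) ^+ (#|S| - graph_rank S)).[1, 1 / p]
    = 0 ^+ (graph_rank [set: edge G] - graph_rank S)
      * ((1 - p) / p) ^+ (#|S| - graph_rank S).
  by rewrite !hornerE /= subrr mulrBl div1r divff.
have conn_ncomp := n_comp_eq1 _ n0.
have ncomp_le S' : (n_comp (adj S') predT <= #|vertex G|)%N := max_card _.
rewrite -connected_byE {1 2}/graph_rank (eqP (etrans (conn_ncomp setT) conn)).
have ncompS : (0 < n_comp (adj S) predT)%N.
  case/card_gt0P: n0 => x _; apply/card_gt0P; exists (fingraph.root (adj S) x).
  by rewrite inE /= roots_root //; apply: sym_connect_sym; apply: adj_sym.
case connS: (connected_by S); last first.
  rewrite mulr0.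
  have : n_comp (adj S) predT != 1%N by rewrite conn_ncomp connS.
  move=> h; rewrite expr0n /= ; case: eqP => [h0|_]; last by rewrite mul0r mulr0.
  exfalso; move: (ncomp_le S) ncompS h h0.
  by move: (n_comp (adj S) predT) #|vertex G| => c n; lia.
have c1 : n_comp (adj S) predT = 1%N by apply/eqP; rewrite conn_ncomp.
have Ssize := connected_size connS.
have Sm : (#|S| <= #|edge G|)%N := max_card _.
rewrite /graph_rank /cyclomatic_number c1 subnn expr0 mul1r mulr1.
set n := #|vertex G| in n0 Ssize *; set m := #|edge G| in Sm *.
set s := #|S| in Ssize Sm *.
have -> : (m + 1 - n = (m - s) + (s - (n - 1)))%N by lia.
have -> : (1 - p) ^+ s = (1 - p) ^+ (n - 1) * (1 - p) ^+ (s - (n - 1)).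
  by rewrite -exprD; congr (_ ^+ _); lia.
rewrite exprD expr_div_n; field.
by rewrite expf_neq0.
Qed.

Theorem theorem5p1 (G : multigraph) (le : rel (edge G)) (A : full_orientation G)
    (p : rat) (k l : nat) :
  connected_graph G ->
  antisymmetric le -> transitive le -> total le ->
  0 < p -> p < 1 / 2%:R ->
  (0 < k)%N -> (0 < l)%N ->
  p = k%:R / (2 * k + l)%N%:R ->
  reliability G p =
    uniform_prob (fun w : chromatic_orientation G k l =>
                    cut_minimal le A (underlying w)).
Proof.
move=> conn le_anti le_trans le_total p0 _ k0 _ pE.
rewrite (reliability_mixed le A conn p0) -(mixed_probability_set0 le A k0 pE).
by rewrite (mixed_probability_const A p le_anti le_trans le_total).
Qed.
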